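(* Let $q$ be a prime power, $r\ge4$, and let $S\subseteq\mathrm{PG}(r,q)$ be an even set of size $q^{r-1}+2q^{r-2}$. Assume that there exists at least one plane meeting $S$ in exactly $q+2$ points and that for every such plane $\pi$ and every $3$-dimensional subspace $\Sigma\supseteq\pi$, the set $S\cap\Sigma$ is a hypercylinder in $\Sigma$. Then $S$ is a hypercylinder in $\mathrm{PG}(r,q)$.
   Context: A set $S$ of points of $\mathrm{PG}(r,q)$ is an even set if every line meets $S$ in an even number of points. A hyperoval of a projective plane $\mathrm{PG}(2,q)$ is a set of $q+2$ points no three collinear. A hypercylinder in $\mathrm{PG}(m,q)$ ($m\ge3$) is obtained as follows: take an $(m-3)$-dimensional subspace $\pi$, a plane $\sigma$ disjoint from $\pi$, and a hyperoval $\mathcal{H}\subseteq\sigma$; the hypercylinder is $\left(\bigcup_{P\in\mathcal{H}}\langle P,\pi\rangle\right)\setminus\pi$ (for $m=3$, $\pi$ is a point). *)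

(* Defs.v *)
From HB Require Import structures.
From mathcomp Require Import all_boot all_order all_algebra.

Set Implicit Arguments.
Unset Strict Implicit.
Unset Printing Implicit Defensive.

(* The subType structure of {vspace _} is only available from this module. *)
Section FiniteVspace.
Import VectorInternalTheory.
Variables (F : finFieldType) (vT : vectType F).
HB.instance Definition _ := [Countable of {vspace vT} by <:].
HB.instance Definition _ := [Finite of {vspace vT} by <:].
End FiniteVspace.

(* PG(r, F) is the lattice of subspaces of F^(r+1), so a subspace of projective
   dimension k is a vector subspace of dimension k + 1. *)
Notation pgspace F r := {vspace 'rV[F]_(r.+1)}.

Section ProjectiveSpace.

Variables (F : finFieldType) (r : nat).
Implicit Types U W L : pgspace F r.

Definition has_pdim (k : nat) U : bool := \dim U == k.+1.

Record pgpoint := PGPoint {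
  pgpoint_val :> pgspace F r;
  pgpoint_pdim : has_pdim 0 pgpoint_val
}.

HB.instance Definition _ := [isSub for pgpoint_val].
HB.instance Definition _ := [Finite of pgpoint by <:].

Implicit Types (P Q : pgpoint) (S H : {set pgpoint}).

Definition pgpoints U : {set pgpoint} := [set P : pgpoint | (P <= U)%VS].

Definition even_set S : Prop :=
  forall L, has_pdim 1 L -> ~~ odd #|S :&: pgpoints L|.

Definition collinear P1 P2 P3 : Prop :=
  exists L, has_pdim 1 L /\ [/\ (P1 <= L)%VS, (P2 <= L)%VS & (P3 <= L)%VS].

Definition hyperoval (sigma : pgspace F r) H : Prop :=
  [/\ has_pdim 2 sigma, H \subset pgpoints sigma, #|H| = #|F| + 2 &
      forall P1 P2 P3, P1 \in H -> P2 \in H -> P3 \in H ->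
        P1 != P2 -> P1 != P3 -> P2 != P3 -> ~ collinear P1 P2 P3].

(* S is a hypercylinder in the m-dimensional projective space W. *)
Definition hypercylinder (m : nat) W S : Prop :=
  [/\ 3 <= m, has_pdim m W &
  exists (pi sigma : pgspace F r) (H : {set pgpoint}),
    [/\ (pi <= W)%VS, has_pdim (m - 3) pi, (sigma <= W)%VS,
        (sigma :&: pi)%VS = 0%VS & hyperoval sigma H] /\
    S = (\bigcup_(P in H) pgpoints (P + pi)%VS) :\: pgpoints pi].

End ProjectiveSpace.

(* Main.v *)
Require Import Defs.
From HB Require Import structures.
From mathcomp Require Import all_boot all_order all_algebra.
From mathcomp Require Import zify.

Set Implicit Arguments.
Unset Strict Implicit.
Unset Printing Implicit Defensive.

Import GRing.Theory.

(* Identify S with the set of nonzero vectors spanning its points. The vectors v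
   whose translation preserves this set form a subspace R, and S is a cone over
   R, so it suffices that R and a hyperoval plane sigma together span the whole
   space. If v is the vertex of a cylindrical solid W and x is outside W, then
   in the 4-space <W, x> every solid missing v has q^2 + 2q points of S, out of
   q^3 + 2q^2. Counting along pencils, the property "every hyperplane missing v
   contains a fraction 1/q of S" passes to all subspaces through v, down to the
   line <x, v>; hence v is in R. For q > 2 the vertex of a cylindrical solid
   through sigma is never in sigma, because q does not divide q + 2. For q = 2
   evenness says that S is the complement of a hyperplane, which is then R. *)

(** * Sums of weights over vector subspaces, and averaging along pencils *)

Section SubspaceSums.

Variables (F : finFieldType) (n : nat).
Local Notation V := 'rV[F]_n.
Implicit Types (U T H : {vspace V}) (v x y : V) (f : V -> nat).

Lemma mem_add_line U v x a :
  x \in U -> (x + a *: v)%R \in (U + <[v]>)%VS.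
Proof. by move=> Ux; rewrite memv_add // memvZ // memv_line. Qed.

Lemma dim_add_line U v : v \notin U -> \dim (U + <[v]>) = (\dim U).+1.
Proof.
move=> vU; rewrite dimv_disjoint_sum ?dim_vline.
  by case: eqP vU => [->|_]; rewrite ?mem0v // addn1.
apply/eqP; rewrite -subv0; apply/subvP=> x /memv_capP[Ux /vlineP[k xE]].
rewrite memv0 xE; apply: contraNT vU; rewrite scaler_eq0 negb_or => /andP[k0 _].
by rewrite -(scalerK k0 v) -xE memvZ.
Qed.

Lemma sum_add_line f U v : v \notin U ->
  \sum_(x in (U + <[v]>)%VS) f x = \sum_(a : F) \sum_(x in U) f (x + a *: v)%R.
Proof.
move=> vU; pose h (p : F * V) := (p.2 + p.1 *: v)%R.
pose A := [pred p : F * V | p.2 \in U].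
have hI : {in A &, injective h}.
  move=> [a x] [b y]; rewrite !inE /h /= => Ux Uy E.
  suff ab : a = b by move: E; rewrite ab => /addIr ->.
  apply/eqP; rewrite -subr_eq0; apply: contraNT vU => ab0.
  rewrite -(scalerK ab0 v) memvZ // scalerBl.
  have -> : (a *: v - b *: v = y - x)%R.
    by apply/eqP; rewrite subr_eq addrAC -E addrAC subrr add0r.
  exact: memvB.
have -> : \sum_(x in (U + <[v]>)%VS) f x = \sum_(x in [set h p | p in A]) f x.
  apply: eq_bigl => x; apply/idP/imsetP.
    move=> /memv_addP[u Uu [w /vlineP[k ->] ->]].
    by exists (k, u); rewrite ?inE.
  by move=> [[a u]]; rewrite inE /= => Uu ->; apply: mem_add_line.
rewrite big_imset //= (pair_big xpredT (mem U)) /=.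
by apply: eq_big => [[a x]|].
Qed.

Lemma sum_line f v : v != 0%R ->
  \sum_(x in <[v]>%VS) f x = \sum_(a : F) f (a *: v)%R.
Proof.
move=> v0; rewrite -[<[v]>%VS]add0v sum_add_line ?memv0 //.
apply: eq_bigr => a _; rewrite (big_pred1 0%R) ?add0r // => x.
by rewrite memv0.
Qed.

(* Each vector of [U + <v> + <y>] outside [U] lies in exactly one of the
   [#|F| + 1] subspaces strictly between. *)
Lemma sum_pencil f U v y : v \notin U -> y \notin (U + <[v]>)%VS ->
  \sum_(x in (U + <[v]> + <[y]>)%VS) f x + #|F| * \sum_(x in U) f x =
  \sum_(x in (U + <[v]>)%VS) f x +
  \sum_(c : F) \sum_(x in (U + <[y + c *: v]>)%VS) f x.
Proof.
move=> vU yU.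
have ycU c : (y + c *: v)%R \notin U.
  apply: contraNN yU => ycU; rewrite -(addrK (c *: v)%R y) -scaleNr.
  exact: mem_add_line.
under [X in _ = _ + X]eq_bigr => c _.
  rewrite sum_add_line // (bigD1 0%R) //=.
  under eq_bigr do rewrite scale0r addr0.
  over.
rewrite big_split /= sum_nat_const sum_add_line // (bigD1 0%R) //=.
under eq_bigr do rewrite scale0r addr0.
rewrite -!addnA; congr (_ + _); rewrite addnC; congr (_ + _).
(* For [b != 0], the substitution of [b * c] for the coefficient of [v] turns
   [b *: y + (b * c) *: v] into [b *: (y + c *: v)]. *)
rewrite [RHS]exchange_big /=; apply: eq_bigr => b b0.
rewrite sum_add_line // (reindex_inj (mulfI b0)) /=.
apply: eq_bigr => c _; apply: eq_bigr => x _.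
by rewrite scalerDr scalerA -addrA [(b *: y + _)%R]addrC.
Qed.

Definition invariant_in f U v := forall x a, x \in U -> f (x + a *: v)%R = f x.

Lemma sum_invariant f H U v : v \notin H -> (H + <[v]>)%VS = U ->
  invariant_in f U v -> \sum_(x in U) f x = #|F| * \sum_(x in H) f x.
Proof.
move=> vH <- inv; rewrite sum_add_line //.
rewrite -sum_nat_const; apply: eq_bigr => a _; apply: eq_bigr => x Hx.
by rewrite inv // (subvP (addvSl _ _)).
Qed.

(* The averaged form of invariance under [v], which passes to subspaces. *)
Definition balanced f v U := forall H, v \notin H -> (H + <[v]>)%VS = U ->
  \sum_(x in U) f x = #|F| * \sum_(x in H) f x.

(** Apply the pencil identity to [H], a complement of [v] in [T]. Apart from [T], the members of the
    pencil are the [H + <[y + c *: v]>], all complements of [v] in [T + <[y]>], so each carries a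
    fraction 1/q of the total. Together these q members account for the whole total, which leaves
    the relation between [T] and [H]. *)
Lemma balanced_hyperplane f v T y : v \in T -> y \notin T ->
  balanced f v (T + <[y]>)%VS -> balanced f v T.
Proof.
move=> vT yT bal H vH HT.
have yH : y \notin (H + <[v]>)%VS by rewrite HT.
have := sum_pencil f vH yH; rewrite HT.
have E c : \sum_(x in (T + <[y]>)%VS) f x =
    #|F| * \sum_(x in (H + <[y + c *: v]>)%VS) f x.
  apply: bal.
    (* If [v = h + k *: (y + c *: v)], then [k != 0] because [v] is not in [H]; solving for [y]
       would put it in [T]. *)
    apply: contraNN yT => /memv_addP[h Hh [w /vlineP[k ->] vE]].
    have HsT : {subset H <= T} by apply/subvP; rewrite -HT addvSl.
    have k0 : k != 0%R.
      by apply: contraNneq vH => k0; rewrite vE k0 scale0r addr0.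
    have : (k *: (y + c *: v) \in T)%R.
      have -> : (k *: (y + c *: v) = v - h)%R by rewrite {2}vE [(h + _)%R]addrC addrK.
      by rewrite memvB // HsT.
    move=> /(memvZ k^-1%R); rewrite scalerK // => ycT.
    by rewrite -(addrK (c *: v)%R y) memvB // memvZ.
  rewrite -HT -!addvA; congr (_ + _)%VS.
  rewrite addvC; apply/eqP; rewrite eqEsubv !subv_add !addvSl /= -!memvE.
  rewrite [(<[v]> + <[y]>)%VS]addvC mem_add_line ?memv_line //= addvC.
  rewrite -[X in X \in _](addrK (c *: v)%R y) -scaleNr mem_add_line //.
  by rewrite memv_line.
move/(congr1 (muln #|F|)); rewrite !mulnDr [X in _ = _ + X]big_distrr /=.
rewrite -(eq_bigr _ (fun c _ => E c)).
have F0 : 0 < #|F| by apply/card_gt0P; exists 0%R.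
by rewrite sum_nat_const addnC => /addIn/eqP; rewrite eqn_pmul2l // => /eqP <-.
Qed.

Lemma balanced_sub f v U T : v \in T -> (T <= U)%VS ->
  balanced f v U -> balanced f v T.
Proof.
have [m] := ubnP (\dim U - \dim T); elim: m T => // m IH T dm vT TU bal.
have [UT|/subvPn[y Uy yT]] := boolP (U <= T)%VS.
  by have -> : T = U by apply/eqP; rewrite eqEsubv TU.
have TyU : (T + <[y]> <= U)%VS by rewrite subv_add TU -memvE.
apply: (@balanced_hyperplane _ _ _ y) => //; apply: IH => //; last first.
  by apply: (subvP (addvSl _ _)).
by have := dimvS TyU; rewrite dim_add_line // => ?; move: dm; lia.
Qed.

End SubspaceSums.

(** * Point sets as sets of vectors closed under nonzero scalars *)

Section VectorsOfPoints.

Variables (F : finFieldType) (r : nat).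
Local Notation V := 'rV[F]_(r.+1).
Implicit Types (S H : {set pgpoint F r}) (P Q : pgpoint F r).
Implicit Types (U W sigma : pgspace F r) (x y v w : V).

Lemma pgpoint_line P : exists2 x, x != 0%R & pgpoint_val P = <[x]>%VS.
Proof.
have dP := eqP (pgpoint_pdim P).
have P0 : vpick P != 0%R by rewrite vpick0 -dimv_eq0 dP.
exists (vpick P) => //; apply/eqP; rewrite eq_sym eqEdim dim_vline P0 dP.
by rewrite -memvE memv_pick.
Qed.

Lemma line_pgpoint x : x != 0%R -> exists P, pgpoint_val P = <[x]>%VS.
Proof.
move=> x0; have dx : has_pdim 0 <[x]>%VS by rewrite /has_pdim dim_vline x0.
by exists (PGPoint dx).
Qed.

Definition vec_in S x := [exists P in S, pgpoint_val P == <[x]>%VS].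

Lemma vec_inP S x :
  reflect (exists2 P, P \in S & pgpoint_val P = <[x]>%VS) (vec_in S x).
Proof.
by apply: (iffP exists_inP) => -[P PS /eqP Px]; exists P => //; apply/eqP.
Qed.

Lemma vec_in_pgpoint S P x : pgpoint_val P = <[x]>%VS -> vec_in S x = (P \in S).
Proof.
move=> Px; apply/vec_inP/idP => [[Q QS Qx]|PS]; last by exists P.
by have -> : P = Q by apply: val_inj; rewrite /= Px Qx.
Qed.

Lemma vec_in0 S : vec_in S 0%R = false.
Proof.
apply/vec_inP => -[P _ E]; have := pgpoint_pdim P.
by rewrite E /has_pdim dim_vline eqxx.
Qed.

Lemma vlineZ (a : F) x : a != 0%R -> <[a *: x]>%VS = <[x]>%VS.
Proof.
move=> a0; apply/eqP; rewrite eqEsubv -!memvE memvZ ?memv_line //=.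
by rewrite -{1}(scalerK a0 x) memvZ ?memv_line.
Qed.

Lemma vec_inZ S (a : F) x : a != 0%R -> vec_in S (a *: x)%R = vec_in S x.
Proof. by move=> a0; rewrite /vec_in vlineZ. Qed.

Lemma vec_in_cap S U x : vec_in (S :&: pgpoints U) x = vec_in S x && (x \in U).
Proof.
have [->|x0] := eqVneq x 0%R; first by rewrite !vec_in0.
have [P Px] := line_pgpoint x0.
by rewrite !(vec_in_pgpoint _ Px) !inE Px memvE.
Qed.

Lemma sum_vec_in_line S x : x != 0%R ->
  \sum_(y in <[x]>%VS) vec_in S y = #|F|.-1 * vec_in S x.
Proof.
move=> x0; rewrite (sum_line (fun y => vec_in S y : nat)) //.
rewrite (bigD1 0%R) //= scale0r vec_in0 add0n -(cardC1 (0%R : F)) -sum_nat_const.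
by apply: eq_big => // a a0; rewrite vec_inZ.
Qed.

(** Every point is spanned by exactly q - 1 nonzero vectors, and the zero vector spans no point. *)
Lemma sum_vec_in S U :
  \sum_(x in U) vec_in S x = #|F|.-1 * #|S :&: pgpoints U|.
Proof.
have E x : (vec_in S x : nat) = \sum_(P in S) vec_in [set P] x.
  have [->|x0] := eqVneq x 0%R.
    by rewrite vec_in0 big1 // => P _; rewrite vec_in0.
  have [P Px] := line_pgpoint x0.
  rewrite (vec_in_pgpoint _ Px).
  under [RHS]eq_bigr do rewrite (vec_in_pgpoint _ Px) in_set1.
  have [PS|PS] := boolP (P \in S).
    rewrite (bigD1 P) //= eqxx big1 // => Q /andP[_ QP].
    by rewrite eq_sym (negbTE QP).
  by rewrite big1 // => Q QS; case: eqP => // PQ; rewrite PQ QS in PS.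
rewrite (eq_bigr _ (fun x _ => E x)) exchange_big /= mulnC -sum_nat_const.
rewrite big_mkcond [RHS]big_mkcond; apply: eq_bigr => P _; rewrite !inE.
case: (P \in S) => //=; have [p p0 Pp] := pgpoint_line P.
have onP x : vec_in [set P] x -> <[x]>%VS = <[p]>%VS.
  by move=> /vec_inP[Q /set1P -> <-].
rewrite Pp -memvE; case: ifP => pU; last first.
  rewrite big1 // => x xU; case: (boolP (vec_in _ x)) => // /onP xp.
  by move: pU; rewrite memvE -xp -memvE xU.
transitivity (\sum_(x in <[p]>%VS) vec_in [set P] x); last first.
  by rewrite sum_vec_in_line // (vec_in_pgpoint _ Pp) set11 muln1.
rewrite big_mkcond [RHS]big_mkcond; apply: eq_bigr => x _.
case: (boolP (vec_in _ x)) => [/onP xp|_]; last by rewrite !if_same.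
by rewrite !memvE xp -memvE pU subvv.
Qed.

(** In a solid the vertex [pi] is a single point [<[v]>]. Membership in the cone depends only on
    subspaces containing [v], so translating by [v] does not affect it. *)
Lemma hypercylinder3P S W : hypercylinder 3 W (S :&: pgpoints W) ->
  exists v sigma, [/\ v \notin sigma, (sigma + <[v]>)%VS = W,
    invariant_in (fun x => vec_in S x : nat) W v &
    hyperoval sigma (S :&: pgpoints sigma)].
Proof.
move=> [_ /eqP dW [pi [sigma [H [[piW /eqP dpi sW spi0 hH] SE]]]]].
have [v v0 piE] : exists2 v, v != 0%R & pi = <[v]>%VS.
  exact: (pgpoint_line (PGPoint (introT eqP dpi : has_pdim 0 pi))).
have [/eqP ds Hs _ _] := hH; rewrite piE in piW spi0 SE.
have vs : v \notin sigma.
  apply: contraNN v0 => vs.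
  by rewrite -memv0 -spi0; apply/memv_capP; rewrite memv_line.
have inW x : x \in W -> vec_in S x =
    [exists P in H, x \in (P + <[v]>)%VS] && (x \notin <[v]>%VS).
  move=> xW; have [->|x0] := eqVneq x 0%R.
    by rewrite vec_in0 mem0v andbF.
  have [P Px] := line_pgpoint x0.
  have -> : vec_in S x = vec_in (S :&: pgpoints W) x.
    by rewrite vec_in_cap xW andbT.
  rewrite SE (vec_in_pgpoint _ Px) !inE Px -memvE andbC; congr (_ && _).
  apply/bigcupP/exists_inP => -[Q QH]; rewrite ?inE ?Px => xQ; exists Q => //.
  by rewrite inE Px -memvE.
exists v, sigma; split => //.
- apply/eqP; rewrite eqEdim subv_add sW piW dW dim_add_line //.
  by rewrite ds.
- move=> x a xW; congr nat_of_bool.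
  have avv U : (<[v]> <= U)%VS -> ((x + a *: v)%R \in U) = (x \in U).
    move=> vU; have avU : (a *: v)%R \in U by rewrite memvZ // memvE.
    apply/idP/idP => [|xU]; last exact: memvD.
    by move=> /memvB/(_ avU); rewrite addrK.
  rewrite !inW ?avv //; congr (_ && _); apply: eq_existsb => P.
  by rewrite avv // addvSr.
(* The base is recovered as a plane section: a point of [sigma] on the line joining [Q] in [H] to
   the vertex must be [Q], since [sigma] misses the vertex. *)
suff -> : S :&: pgpoints sigma = H by [].
apply/setP => P; have [x x0 Px] := pgpoint_line P.
rewrite -!(vec_in_pgpoint _ Px) vec_in_cap.
have [xs|xs] := boolP (x \in sigma); last first.
  rewrite andbF (vec_in_pgpoint _ Px); apply/esym/negbTE.
  by apply: contraNN xs => /(subsetP Hs); rewrite inE Px memvE.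
rewrite andbT inW ?(subvP sW) //.
have xv : x \notin <[v]>%VS.
  apply: contraNN x0 => xv; rewrite -memv0 -spi0; exact/memv_capP.
rewrite xv andbT; apply/exists_inP/vec_inP => -[Q QH]; last first.
  by move=> Qx; exists Q; rewrite // Qx (subvP (addvSl _ _)) ?memv_line.
have [y y0 Qy] := pgpoint_line Q; rewrite Qy.
move=> /memv_addP[_ /vlineP[k ->] [z zv xE]].
have ys : y \in sigma by have := subsetP Hs _ QH; rewrite inE Qy memvE.
have z0 : z = 0%R.
  apply/eqP; rewrite -memv0 -spi0; apply/memv_capP; split => //.
  have -> : z = (x - k *: y)%R by rewrite xE addrC addKr.
  by rewrite memvB // memvZ.
exists Q => //; rewrite Qy xE z0 addr0 vlineZ //.
by apply: contraNneq x0 => k0; rewrite xE z0 k0 scale0r addr0.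
Qed.

(** * Cylindrical solids and their vertices *)

Definition cylindrical S := forall pi Sigma : pgspace F r,
  has_pdim 2 pi -> #|S :&: pgpoints pi| = #|F| + 2 ->
  has_pdim 3 Sigma -> (pi <= Sigma)%VS ->
  hypercylinder 3 Sigma (S :&: pgpoints Sigma).

Lemma sum_vec_in_solid S pi W : cylindrical S ->
  has_pdim 2 pi -> #|S :&: pgpoints pi| = #|F| + 2 ->
  has_pdim 3 W -> (pi <= W)%VS ->
  \sum_(x in W) vec_in S x = #|F| * (#|F|.-1 * (#|F| + 2)).
Proof.
move=> cS dpi Spi dW piW.
have [v [s [vs sW inv [_ _ cs _]]]] := hypercylinder3P (cS _ _ dpi Spi dW piW).
rewrite (sum_invariant (f := fun x => vec_in S x : nat) vs sW) //.
by rewrite sum_vec_in cs.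
Qed.

Lemma notin_line_sym v w : v != 0%R -> w \notin <[v]>%VS -> v \notin <[w]>%VS.
Proof.
move=> v0; apply: contraNN => /vlineP[k vE].
have k0 : k != 0%R by apply: contraNneq v0 => k0; rewrite vE k0 scale0r.
by rewrite -(scalerK k0 w) -vE memvZ ?memv_line.
Qed.

(* In the 4-space spanned by the solid and [x], every solid missing the vertex
   [v] meets the given one in a plane missing [v], so it is again a cylinder:
   all these solids have the same number of points of [S]. *)
Lemma vertex_invariant S sigma v : cylindrical S ->
  has_pdim 2 sigma -> #|S :&: pgpoints sigma| = #|F| + 2 -> v \notin sigma ->
  invariant_in (fun x => vec_in S x : nat) (sigma + <[v]>)%VS v ->
  forall x, vec_in S (x + v)%R = vec_in S x.
Proof.
move=> cS ds cs vs inv x; set f := fun x => vec_in S x : nat in inv.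
have v0 : v != 0%R by apply: contraNneq vs => ->; rewrite mem0v.
have bE (b1 b2 : bool) : b1 = b2 :> nat -> b1 = b2 by case: b1; case: b2.
have [xW|xW] := boolP (x \in (sigma + <[v]>)%VS).
  by apply: bE; have := inv x 1%R xW; rewrite scale1r.
set W := (sigma + <[v]>)%VS in inv xW.
have dimW : \dim W = 4 by rewrite dim_add_line // (eqP ds).
have pdimW y : y \notin sigma -> has_pdim 3 (sigma + <[y]>)%VS.
  by move=> ys; rewrite /has_pdim dim_add_line // (eqP ds).
have q1 : 1 < #|F| := card_finNzRing_gt1 F.
have solid U : has_pdim 3 U -> (exists pi, [/\ has_pdim 2 pi,
    #|S :&: pgpoints pi| = #|F| + 2 & (pi <= U)%VS]) ->
    \sum_(y in U) f y = #|F| * (#|F|.-1 * (#|F| + 2)).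
  by move=> dU [pi [dpi cpi piU]]; exact: (sum_vec_in_solid (pi := pi)).
(* Let N be the sum over [sigma]. The q + 1 solids through [sigma] in the 4-space each have sum qN;
   removing the q surplus copies of [sigma] leaves q * (qN). *)
have tot : \sum_(y in (W + <[x]>)%VS) f y =
    #|F| * (#|F| * (#|F|.-1 * (#|F| + 2))).
  have Ns : \sum_(y in sigma) f y = #|F|.-1 * (#|F| + 2).
    by rewrite sum_vec_in cs.
  have := sum_pencil f vs xW.
  rewrite Ns (solid W) ?pdimW //; last by exists sigma; rewrite addvSl.
  rewrite [in X in _ = _ + X](eq_bigr (fun _ => #|F| * (#|F|.-1 * (#|F| + 2)))).
    by rewrite sum_nat_const addnC => /addnI.
  move=> c _; apply: solid; last by exists sigma; rewrite addvSl.
  apply: pdimW; apply: contraNN xW => xcs.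
  by rewrite -(addrK (c *: v)%R x) -scaleNr mem_add_line.
have bal : balanced f v (W + <[x]>)%VS.
  move=> H vH HE; rewrite tot; congr (_ * _).
  have dH : \dim H = 4.
    by have := dim_add_line vH; rewrite HE dim_add_line // dimW => -[].
  (* At least 3 by the dimension formula inside a space of vector dimension 5; not 4, because [v]
     lies in [W] but not in [H]. *)
  have dWH : \dim (H :&: W) = 3.
    have := dimv_sum_cap H W; rewrite dH dimW.
    have : \dim (H + W) <= 5.
      rewrite -[5]/(4.+1) -dimW -(dim_add_line xW) dimvS //.
      by rewrite subv_add addvSl -HE addvSl.
    have : \dim (H :&: W) < 4.
      rewrite -dimW ltn_neqAle dimvS ?capvSr // andbT.
      apply: contraNN vH => /eqP dE.
      suff /eqP HW : (H :&: W)%VS == W.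
        have : v \in (H :&: W)%VS.
          by rewrite HW (subvP (addvSr _ _)) ?memv_line.
        by case/memv_capP.
      by rewrite eqEdim capvSr dE leqnn.
    lia.
  have vHW : v \notin (H :&: W)%VS by apply: contraNN vH => /memv_capP[].
  have HWE : (H :&: W + <[v]>)%VS = W.
    apply/eqP; rewrite eqEdim dim_add_line // dWH dimW subv_add capvSr addvSr.
    by [].
  rewrite (solid H) //; first by rewrite /has_pdim dH.
  exists (H :&: W)%VS; rewrite capvSl /has_pdim dWH; split => //.
  (* Invariance under [v] gives the plane [H :&: W] a fraction 1/q of [W], hence exactly q + 2
     points, so [H] contains an admissible plane. *)
  have := sum_invariant vHW HWE inv.
  rewrite (solid W) ?pdimW //; last by exists sigma; rewrite addvSl.
  rewrite sum_vec_in => /eqP; rewrite !eqn_pmul2l ?(ltnW q1) //; last by lia.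
  by move/eqP.
(* Balance on the line joining [x] and [v] says that each of its points other than [v] determines
   the same sum; this is used for both [x] and [x + v]. *)
have line w : w \notin <[v]>%VS -> (<[w]> + <[v]>)%VS = (<[x]> + <[v]>)%VS ->
    \sum_(y in (<[x]> + <[v]>)%VS) f y = #|F| * (#|F|.-1 * vec_in S w).
  move=> wv wE; rewrite -sum_vec_in_line; last first.
    by apply: contraNneq wv => ->; rewrite mem0v.
  apply: (balanced_sub (U := (W + <[x]>)%VS) (v := v)) => //.
  - by rewrite (subvP (addvSr _ _)) ?memv_line.
  - by rewrite subv_add addvSr (subv_trans (addvSr _ _) (addvSl _ _)).
  - exact: notin_line_sym.
have xv : x \notin <[v]>%VS by apply: contraNN xW; apply/subvP/addvSr.
have xvv : (x + v)%R \notin <[v]>%VS.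
  by apply: contraNN xv => xvv; rewrite -(addrK v x) memvB ?memv_line.
have xvE : (<[(x + v)%R]> + <[v]>)%VS = (<[x]> + <[v]>)%VS.
  apply/eqP; rewrite eqEsubv !subv_add !addvSr -!memvE !andbT.
  rewrite -{1}(scale1r v) mem_add_line ?memv_line //=.
  by rewrite -{1}(addrK v x) -scaleN1r mem_add_line ?memv_line.
apply/bE/eqP; rewrite -(eqn_pmul2l (m := #|F|.-1)); last by lia.
by rewrite -(eqn_pmul2l (m := #|F|)) -?line ?(ltnW q1).
Qed.

(** * The radical and the cone over it *)

Definition radical S : pgspace F r :=
  (\sum_(v | [forall x, vec_in S (x + v)%R == vec_in S x]) <[v]>)%VS.

Lemma mem_radical S v :
  (forall x, vec_in S (x + v)%R = vec_in S x) -> v \in radical S.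
Proof.
move=> inv; rewrite memvE; apply: (sumv_sup v) => //.
by apply/forallP => x; rewrite inv.
Qed.

(** [radical] is a span by definition, so this shows that spanning adds no new kind of vector:
    translations compose, and a nonzero multiple [a *: w] reduces to [w] by rescaling [x]. *)
Lemma radical_invariant S v x : v \in radical S -> vec_in S (x + v)%R = vec_in S x.
Proof.
case/memv_sumP => vs vsP ->; elim/big_rec: _ x => [|w u Pw IH] x.
  by rewrite addr0.
have /vlineP[a ->] := vsP w Pw; rewrite addrA IH.
have [->|a0] := eqVneq a 0%R; first by rewrite scale0r addr0.
rewrite -[in LHS](scalerKV a0 x) -scalerDr vec_inZ // (eqP (forallP Pw _)).
by rewrite vec_inZ ?invr_eq0.
Qed.

(** The radical may meet [sigma], so the vertex is taken to be a complement [pi] of that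
    intersection inside the radical. Then [pi] and [sigma] are complementary in the whole space, and
    [v + p] with [v] in [pi] and [p] in [sigma] belongs to the set exactly when [p] does. *)
Lemma hypercylinder_radical S sigma : 3 <= r ->
  hyperoval sigma (S :&: pgpoints sigma) ->
  (fullv <= radical S + sigma)%VS -> hypercylinder r fullv S.
Proof.
move=> r3 hs full; pose pi := (radical S :\: sigma)%VS.
have [/eqP ds _ _ _] := hs.
have cap0 : (sigma :&: pi)%VS = 0%VS by rewrite capvC capv_diff.
have inv x v : v \in pi -> vec_in S (x + v)%R = vec_in S x.
  by move=> vpi; rewrite radical_invariant // (subvP (diffvSl _ _) _ vpi).
have sumE : (pi + sigma)%VS = fullv.
  by apply/eqP; rewrite eqEsubv subvf addv_diff full.
have dimV : \dim (fullv : pgspace F r) = r.+1 by rewrite dimvf /dim /= mul1n.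
have dpi : \dim pi = r - 2.
  have := dimv_disjoint_sum (capv_diff (radical S) sigma).
  by rewrite -/pi sumE dimV ds; lia.
split; [by [] | by rewrite /has_pdim dimV | ].
exists pi, sigma, (S :&: pgpoints sigma); split.
  by split; rewrite ?subvf // /has_pdim dpi; apply/eqP; lia.
apply/setP => P; have [x x0 Px] := pgpoint_line P.
rewrite -(vec_in_pgpoint _ Px) !inE Px -memvE.
apply/idP/andP => [xS|[xpi /bigcupP[Q]]].
  have /memv_addP[v vpi [p ps xE]] : x \in (pi + sigma)%VS by rewrite sumE memvf.
  have pS : vec_in S p by rewrite -(inv p v vpi) addrC -xE.
  split.
    apply: contraTN pS => xpi; suff -> : p = 0%R by rewrite vec_in0.
    apply/eqP; rewrite -memv0 -cap0; apply/memv_capP; split => //.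
    have -> : p = (x - v)%R by rewrite xE addrC addKr.
    exact: memvB.
  have [Q QS Qp] := vec_inP _ _ pS.
  apply/bigcupP; exists Q; first by rewrite !inE QS Qp -memvE.
  by rewrite inE Px -memvE xE addvC memv_add // Qp memv_line.
have [y y0 Qy] := pgpoint_line Q.
rewrite !inE => /andP[QS _]; rewrite Px Qy -memvE.
move=> /memv_addP[_ /vlineP[k ->] [v vpi xE]].
rewrite xE inv // vec_inZ ?(vec_in_pgpoint _ Qy) //.
by apply: contraNneq xpi => k0; rewrite xE k0 scale0r add0r.
Qed.

(** Over the field of two elements a line consists of the three points [x], [y], [x + y], so
    evenness makes the indicator additive. *)
Lemma even_set_vec_inD S x y : #|F| = 2 -> even_set S ->
  vec_in S (x + y)%R = vec_in S x (+) vec_in S y.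
Proof.
move=> F2 evS.
have F01 (a : F) : a = 0%R \/ a = 1%R.
  suff /eqP E : [set 0%R; 1%R] == [set: F].
    by have : a \in [set: F] by []; rewrite -E => /set2P.
  by rewrite eqEcard subsetT cardsT F2 cards2 eq_sym oner_eq0.
have sumF (g : F -> nat) : \sum_(a : F) g a = g 0%R + g 1%R.
  rewrite (bigD1 0%R) // (bigD1 1%R) ?oner_eq0 //= big_pred0 ?addn0 // => a.
  by case: (F01 a) => ->; rewrite eqxx ?andbF.
have [->|x0] := eqVneq x 0%R; first by rewrite add0r vec_in0.
have [->|xy] := eqVneq y x.
  rewrite addbb.
  have -> : (x + x = 0 :> V)%R; last by rewrite vec_in0.
  rewrite -[x]scale1r -scalerDl; case: (F01 (1 + 1)%R) => [->|/eqP]; first by rewrite scale0r.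
  by rewrite -subr_eq0 addrK oner_eq0.
have [->|y0] := eqVneq y 0%R; first by rewrite addr0 vec_in0 addbF.
have yx : y \notin <[x]>%VS.
  apply/vlineP => -[k yE]; case: (F01 k) => kE.
    by rewrite yE kE scale0r eqxx in y0.
  by rewrite yE kE scale1r eqxx in xy.
have dL : has_pdim 1 (<[x]> + <[y]>)%VS.
  by rewrite /has_pdim dim_add_line // dim_vline x0.
have := sum_vec_in S (<[x]> + <[y]>)%VS; rewrite F2 mul1n.
rewrite (sum_add_line (fun z => vec_in S z : nat)) // sumF.
rewrite !(sum_line (fun z => vec_in S (z + _)%R : nat)) // !sumF.
rewrite !scale0r !scale1r !addr0 add0r vec_in0 add0n => /(congr1 odd).
rewrite (negbTE (evS _ dL)).
by case: (vec_in S x); case: (vec_in S y); case: (vec_in S (x + y)%R).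
Qed.

End VectorsOfPoints.

Theorem theorem5p6 (F : finFieldType) (q r : nat) (hq : #|F| = q) (hr : 4 <= r)
  (S : {set pgpoint F r})
  (hS : even_set S)
  (hcard : #|S| = q ^ (r - 1) + 2 * q ^ (r - 2))
  (hex : exists pi : pgspace F r,
      has_pdim 2 pi /\ #|S :&: pgpoints pi| = q + 2)
  (hcyl : forall pi Sigma : pgspace F r,
      has_pdim 2 pi -> #|S :&: pgpoints pi| = q + 2 ->
      has_pdim 3 Sigma -> (pi <= Sigma)%VS ->
      hypercylinder 3 Sigma (S :&: pgpoints Sigma)) :
  hypercylinder r fullv S.
Proof.
have cS : cylindrical S by rewrite /cylindrical hq.
have q1 : 1 < q by rewrite -hq; exact: card_finNzRing_gt1.
(* The given plane has the right number of points; the base of a cylindrical solid through it is in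
   addition a hyperoval plane. *)
have [sigma hs] : exists sigma, hyperoval sigma (S :&: pgpoints sigma).
  have [pi [dpi cpi]] := hex.
  have [y _ ypi] : exists2 y, y \in (fullv : pgspace F r) & y \notin pi.
    apply/subvPn/negP => /dimvS; rewrite dimvf /dim /= mul1n (eqP dpi); lia.
  have dW : has_pdim 3 (pi + <[y]>)%VS.
    by rewrite /has_pdim dim_add_line // (eqP dpi).
  have [v [s [_ _ _ hs]]] := hypercylinder3P (hcyl _ _ dpi cpi dW (addvSl _ _)).
  by exists s.
have [ds _ cs _] := hs.
apply: (hypercylinder_radical (sigma := sigma)) => //; first exact: ltnW.
apply/subvP => y _.
have [F2|q2] := eqVneq q 2.
  have rad z : ~~ vec_in S z -> z \in radical S.
    move=> zS; apply: mem_radical => x.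
    by rewrite even_set_vec_inD ?hq // (negbTE zS) addbF.
  have [yS|yS] := boolP (vec_in S y); last first.
    by rewrite (subvP (addvSl _ _)) ?rad.
  have [P PH] : exists P, P \in S :&: pgpoints sigma.
    by apply/card_gt0P; rewrite cs addn2.
  have [s s0 Ps] := pgpoint_line P.
  move: PH; rewrite !inE -(vec_in_pgpoint _ Ps) Ps -memvE => /andP[sS ssigma].
  (* Write [y] as [(y + s) - s]: by additivity [y + s] is outside the set, hence in the radical. *)
  rewrite -(addrK s y) memv_add ?memvN //.
  by apply: rad; rewrite even_set_vec_inD ?hq // yS sS.
have [ys|ys] := boolP (y \in sigma); first by rewrite (subvP (addvSr _ _)).
have dW : has_pdim 3 (sigma + <[y]>)%VS.
  by rewrite /has_pdim dim_add_line // (eqP ds).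
have [v [s [vs sW inv [dims _ cards _]]]] :=
  hypercylinder3P (cS _ _ ds cs dW (addvSl _ _)).
have vrad : v \in radical S.
  apply: mem_radical; apply: (vertex_invariant (sigma := s)) => //.
  by rewrite sW.
(* The base [s] of this solid may differ from [sigma]. If [v] were in [sigma], invariance would make
   q + 2 equal to q times the number of points on a line [l] of [sigma] missing [v], so q would
   divide 2. *)
have vsigma : v \notin sigma.
  apply/negP => vsigma; pose l := (sigma :\: <[v]>)%VS.
  have v0 : v != 0%R by apply: contraNneq vs => ->; rewrite mem0v.
  have vl : v \notin l.
    apply: contraNN v0 => vl.
    rewrite -memv0 -(capv_diff sigma <[v]>).
    by apply/memv_capP; rewrite memv_line.
  have lE : (l + <[v]>)%VS = sigma.
    by rewrite addv_diff; apply/addv_idPl; rewrite -memvE.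
  have invs : invariant_in (fun x => vec_in S x : nat) sigma v.
    by move=> x a xs; apply: inv; rewrite (subvP (addvSl _ _)).
  have := sum_invariant vl lE invs.
  rewrite !sum_vec_in cs hq mulnCA => /eqP; rewrite eqn_pmul2l; last by lia.
  move=> /eqP/(congr1 (modn^~ q)); rewrite modnMr modnDl.
  by rewrite modn_small //; lia.
have vW : v \in (sigma + <[y]>)%VS by rewrite -sW (subvP (addvSr _ _)) ?memv_line.
suff sub : (sigma + <[y]> <= radical S + sigma)%VS.
  by apply: (subvP sub); rewrite (subvP (addvSr _ _)) ?memv_line.
(* As [v] lies in the solid but outside [sigma], it can replace [y] as the extra generator. *)
have /eqP <- : (sigma + <[v]>)%VS == (sigma + <[y]>)%VS.
  by rewrite eqEdim subv_add addvSl -memvE vW (dim_add_line vsigma) (dim_add_line ys) leqnn.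
by rewrite addvC addvS // -memvE.
Qed.
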